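(* Let $\ast$ be a star operation of finite type on an integral domain $R$. (1) If $R$ is $\ast$-integrally closed and Clifford $\ast$-regular, then $R$ is a P$v$MD. (2) The following conditions are equivalent: (i) $R$ is $\tilde{\ast}$-integrally closed and Clifford $\tilde{\ast}$-regular; (ii) $R$ is integrally closed and Clifford $\tilde{\ast}$-regular; (iii) $R$ is a P$\ast$MD of $\ast$-finite character. Under any one of the conditions (i)–(iii), $\tilde{\ast}=w$.
   Context: $R$ is an integral domain with field of fractions $K$. An ideal of $R$ means a nonzero fractional ideal (an integral ideal if contained in $R$); prime ideals are integral and nonzero. $\mathcal F(R)$ is the set of ideals, and $(J:I)=\{x\in K: xI\subseteq J\}$. A star operation on $R$ is a map $\mathcal F(R)\to\mathcal F(R)$, $I\mapsto I^\ast$, such that for all $0\ne a\in K$ and $I,J\in\mathcal F(R)$: $R^\ast=R$ and $(aI)^\ast=aI^\ast$; $I\subseteq I^\ast$, and $I\subseteq J$ implies $I^\ast\subseteq J^\ast$; $I^{\ast\ast}=I^\ast$. It is of finite type if $I^\ast=\bigcup\{J^\ast: J\subseteq I,\ J \text{ a finitely generated ideal}\}$ for all $I$. $I$ is a $\ast$-ideal if $I=I^\ast$; a $\ast$-maximal ideal is a maximal element of the set of proper integral $\ast$-ideals; $\ast\text{-Max}(R)$ is the set of $\ast$-maximal ideals. For $\ast$ of finite type, $\tilde{\ast}$ is the star operation $I\mapsto\bigcap_{M\in\ast\text{-Max}(R)}IR_M$. $I^v=(R:(R:I))$, $I^t=\bigcup\{J^v: J\subseteq I \text{ a finitely generated ideal}\}$,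 and $w=\tilde t$. For a star operation $\ast$: $R$ is Clifford $\ast$-regular if for every ideal $I$ of $R$ there is an ideal $J$ of $R$ with $I^\ast=(I^2J)^\ast$. $R$ is $\ast$-integrally closed if $R=R^{[\ast]}$, where $R^{[\ast]}=\bigcup\{(J^\ast:J^\ast): J \text{ a finitely generated ideal of } R\}$. For $\ast$ of finite type, $R$ is a P$\ast$MD if each finitely generated ideal $I$ is $\ast$-invertible, i.e. $(I(R:I))^\ast=R$; a P$v$MD is a P$t$MD. $R$ has $\ast$-finite character if each nonzero element of $R$ is contained in at most finitely many $\ast$-maximal ideals. *)

(* Defs.v *)
From mathcomp Require Import all_boot all_order all_algebra.
From mathcomp Require Import boolp classical_sets cardinality.

Set Implicit Arguments.
Unset Strict Implicit.
Unset Printing Implicit Defensive.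

Import GRing.Theory.
Local Open Scope classical_set_scope.
Local Open Scope ring_scope.

Local Notation "x %:F" := (@tofrac _ x) : ring_scope.

(* Fractional ideals are subsets of the fraction field K = {fraction R}, and R
   itself is seen as a subset of K through the embedding r |-> r%:F. *)

Definition ringR (R : idomainType) : set {fraction R} := range (@tofrac R).

Definition is_submodule (R : idomainType) (I : set {fraction R}) : Prop :=
  [/\ I 0,
      (forall x y, I x -> I y -> I (x + y)) &
      (forall (r : R) x, I x -> I (r%:F * x))].

(* "Ideal" means nonzero fractional ideal. *)
Definition is_ideal (R : idomainType) (I : set {fraction R}) : Prop :=
  [/\ is_submodule I,
      (exists2 x, I x & x != 0) &
      (exists2 d : R, d != 0 & forall x, I x -> ringR (d%:F * x))].

Definition is_fg_ideal (R : idomainType) (I : set {fraction R}) : Prop :=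
  is_ideal I /\
  exists (n : nat) (g : 'I_n -> {fraction R}),
    I = [set x | exists a : 'I_n -> R, x = \sum_(i < n) (a i)%:F * g i].

(* The product of two R-submodules of K: finite sums of products. *)
Definition ideal_mul (R : idomainType) (I J : set {fraction R}) :
    set {fraction R} :=
  [set x | exists (n : nat) (a b : 'I_n -> {fraction R}),
     [/\ forall i, I (a i), forall i, J (b i) & x = \sum_(i < n) a i * b i]].

(* (J : I) *)
Definition colon (R : idomainType) (J I : set {fraction R}) :
    set {fraction R} :=
  [set x | forall y, I y -> J (x * y)].

(* A map I |-> I^* is represented on all subsets of K; its values on subsets
   that are not ideals are never constrained nor used. *)
Definition operation (R : idomainType) : Type :=
  set {fraction R} -> set {fraction R}.

Record is_star_operation (R : idomainType) (star : operation R) : Prop := {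
  star_ideal : forall I, is_ideal I -> is_ideal (star I);
  star_ring : star (@ringR R) = @ringR R;
  star_scale : forall (a : {fraction R}) I, a != 0 -> is_ideal I ->
    star [set a * x | x in I] = [set a * x | x in star I];
  star_ext : forall I, is_ideal I -> I `<=` star I;
  star_mono : forall I J, is_ideal I -> is_ideal J ->
    I `<=` J -> star I `<=` star J;
  star_idem : forall I, is_ideal I -> star (star I) = star I
}.

Definition finite_type (R : idomainType) (star : operation R) : Prop :=
  forall I, is_ideal I ->
    star I = \bigcup_(J in [set J | is_fg_ideal J /\ J `<=` I]) star J.

(* Proper integral *-ideals. *)
Definition proper_star_ideal (R : idomainType) (star : operation R)
    (M : set {fraction R}) : Prop :=
  [/\ is_ideal M, M `<=` @ringR R, M <> @ringR R & star M = M].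

(* *-Max(R) *)
Definition star_Max (R : idomainType) (star : operation R) :
    set (set {fraction R}) :=
  [set M | proper_star_ideal star M /\
           forall N, proper_star_ideal star N -> M `<=` N -> N = M].

(* R_M, as a subring of K. *)
Definition localization (R : idomainType) (M : set {fraction R}) :
    set {fraction R} :=
  [set x | exists r s : R, ~ M s%:F /\ x = r%:F / s%:F].

Definition tilde (R : idomainType) (star : operation R) : operation R :=
  fun I => \bigcap_(M in star_Max star) ideal_mul I (localization M).

Definition v_op (R : idomainType) : operation R :=
  fun I => colon (@ringR R) (colon (@ringR R) I).

Definition t_op (R : idomainType) : operation R :=
  fun I => \bigcup_(J in [set J | is_fg_ideal J /\ J `<=` I]) v_op J.

Definition w_op (R : idomainType) : operation R := tilde (@t_op R).

Definition clifford_regular (R : idomainType) (star : operation R) : Prop :=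
  forall I, is_ideal I ->
    exists2 J, is_ideal J & star I = star (ideal_mul (ideal_mul I I) J).

(* R^[*] *)
Definition star_closure (R : idomainType) (star : operation R) :
    set {fraction R} :=
  \bigcup_(J in [set J | is_fg_ideal J]) colon (star J) (star J).

Definition star_integrally_closed (R : idomainType) (star : operation R) :
    Prop :=
  @ringR R = star_closure star.

Definition integrally_closed (R : idomainType) : Prop :=
  forall x : {fraction R}, integralOver (@tofrac R) x -> ringR x.

Definition PstarMD (R : idomainType) (star : operation R) : Prop :=
  forall I, is_fg_ideal I -> star (ideal_mul I (colon (@ringR R) I)) = @ringR R.

Definition PvMD (R : idomainType) : Prop := PstarMD (@t_op R).

Definition star_finite_character (R : idomainType) (star : operation R) :
    Prop :=
  forall r : R, r != 0 -> finite_set [set M | star_Max star M /\ M r%:F].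

(* Main.v *)
(** For a finitely generated [I], Clifford regularity gives an ideal [Q = I J]
    with [I^* = (I Q)^*], and integral closedness puts [Q] inside [R]. In (1) a
    finitely generated [H] in [Q] already has [I^* = (I H)^*], so [(R : H)] maps
    [I^*] into itself, hence is contained in [R], and [H^v = R]. In (2)
    Nakayama's lemma at each *-maximal ideal shows that [Q] lies in none of
    them, so [R] is a P*MD.

    If a nonzero [a] lay in infinitely many *-maximal ideals, there would be
    finitely generated proper ideals [A_0, A_1, ...] containing [a], no two of
    them in a common *-maximal ideal. The sum [B] of [R] and all the [A_n^-1] is
    locally principal, so Clifford regularity makes it *-invertible; by finite
    type a partial sum of [B] suffices for this, which is absurd at a *-maximal
    ideal containing the next [A_n].

    Conversely the localizations of a P*MD at *-maximal ideals are valuation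
    domains, in which [I^2 (I : I^2) = I]; finite character allows to clear
    denominators and to take [J = (I : I^2)] globally. In a P*MD, [J^*] and
    [J^v] agree on finitely generated ideals, so [*] is [t]. *)

Require Import Defs.
From mathcomp Require Import all_boot all_order all_algebra.
From mathcomp Require Import boolp classical_sets functions cardinality.
From mathcomp Require Import fingroup perm ring.

Set Implicit Arguments.
Unset Strict Implicit.
Unset Printing Implicit Defensive.

Import GRing.Theory.
Local Open Scope classical_set_scope.
Local Open Scope ring_scope.

Local Notation "x %:F" := (@tofrac _ x) : ring_scope.

(** * Fractional ideals *)

Section FractionalIdeals.
Variable R : idomainType.
Local Notation K := {fraction R}.
Local Notation OK := (@ringR R).
Implicit Types (I J L M : set K) (x y z : K) (r s d : R).

Lemma fraction_numden x : exists n d : R, d != 0 /\ x = n%:F / d%:F.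
Proof.
elim/quotW: x => r; exists \n_r, \d_r; split; first exact: denom_ratioP.
have d0 : (\d_r)%:F != 0 :> K by rewrite tofrac_eq0 denom_ratioP.
apply: (mulIf d0); rewrite mulfVK //.
rewrite !piE; apply/eqmodP; rewrite /= FracField.equivfE.
rewrite !(numden_Ratio, mulf_neq0, oner_neq0, denom_ratioP) //.
by rewrite !(mulr1, mul1r) mulrC.
Qed.

Lemma sub0 I : is_submodule I -> I 0. Proof. by case. Qed.

Lemma subD I x y : is_submodule I -> I x -> I y -> I (x + y).
Proof. by case=> _ h _; apply: h. Qed.

Lemma subM I r x : is_submodule I -> I x -> I (r%:F * x).
Proof. by case=> _ _; apply. Qed.

Lemma ringR_tofrac r : OK r%:F. Proof. by exists r. Qed.

Lemma ringR1 : OK 1. Proof. by exists 1; rewrite ?tofrac1. Qed.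

Lemma subMR I x y : is_submodule I -> OK x -> I y -> I (x * y).
Proof. by move=> sI [r _ <-]; apply: subM. Qed.

Lemma ringRM x y : OK x -> OK y -> OK (x * y).
Proof. by move=> [r _ <-] [s _ <-]; exists (r * s); rewrite ?tofracM. Qed.

Lemma ringR_submodule : is_submodule OK.
Proof.
split; first by exists 0; rewrite ?tofrac0.
- by move=> _ _ [r _ <-] [s _ <-]; exists (r + s); rewrite ?tofracD.
- by move=> r x; apply/ringRM/ringR_tofrac.
Qed.

Lemma ideal_sub I : is_ideal I -> is_submodule I. Proof. by case. Qed.
Hint Resolve ideal_sub ringR_submodule ringR1 ringR_tofrac : core.

Lemma subN I x : is_submodule I -> I x -> I (- x).
Proof. by move=> sI Ix; rewrite -mulN1r -tofrac1 -tofracN; apply: subM. Qed.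

Lemma sub_sum I (T : Type) (s : seq T) (P : pred T) (f : T -> K) :
  is_submodule I -> (forall i, P i -> I (f i)) -> I (\sum_(i <- s | P i) f i).
Proof.
move=> sI If; elim/big_ind: _ => //; first exact: sub0.
by move=> x y; apply: subD.
Qed.

Lemma ideal_mulI I J x y : I x -> J y -> ideal_mul I J (x * y).
Proof.
move=> Ix Jy; exists 1%N, (fun=> x), (fun=> y); split => //.
by rewrite big_ord_recl big_ord0 addr0.
Qed.

Lemma ideal_mul_min I J L : is_submodule L ->
  (forall x y, I x -> J y -> L (x * y)) -> ideal_mul I J `<=` L.
Proof.
by move=> sL h x [n [a [b [Ia Jb ->]]]]; apply: sub_sum => // i _; apply: h.
Qed.

Lemma ideal_mul_submodule I J :
  (forall r x, I x -> I (r%:F * x)) -> is_submodule (ideal_mul I J).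
Proof.
move=> sI; split.
- by exists 0, (fun=> 0), (fun=> 0); split; [case|case|rewrite big_ord0].
- move=> x y [n [a [b [Ia Jb ->]]]] [m [c [e [Ic Je ->]]]].
  exists (n + m)%N,
    (fun i => match fintype.split i with inl j => a j | inr j => c j end),
    (fun i => match fintype.split i with inl j => b j | inr j => e j end).
  split; try by move=> i; case: fintype.split.
  rewrite big_split_ord /=; congr (_ + _); apply: eq_bigr => i _.
    by rewrite (unsplitK (inl i)).
  by rewrite (unsplitK (inr i)).
- move=> r x [n [a [b [Ia Jb ->]]]]; exists n, (fun i => r%:F * a i), b.
  split=> //; first by move=> i; apply: sI.
  by rewrite mulr_sumr; apply: eq_bigr => i _; rewrite mulrA.
Qed.

Lemma submodule_mul I J : is_submodule I -> is_submodule (ideal_mul I J).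
Proof. by move=> sI; apply: ideal_mul_submodule => r x; apply: subM. Qed.
Hint Resolve submodule_mul : core.

Lemma ideal_mulSS I J I' J' : I `<=` I' -> J `<=` J' ->
  ideal_mul I J `<=` ideal_mul I' J'.
Proof.
move=> sI sJ x [n [a [b [Ia Jb ->]]]].
by exists n, a, b; split => // i; [apply: sI|apply: sJ].
Qed.

Lemma ideal_mulA I J L : is_submodule I ->
  ideal_mul (ideal_mul I J) L = ideal_mul I (ideal_mul J L).
Proof.
move=> sI; apply/seteqP; split.
  apply: ideal_mul_min; first exact: submodule_mul.
  move=> _ c [n [a [b [Ia Jb ->]]]] Lc; rewrite mulr_suml.
  apply: sub_sum => [|i _]; first exact: submodule_mul.
  by rewrite -mulrA; apply/ideal_mulI/ideal_mulI.
apply: ideal_mul_min; first exact/submodule_mul/submodule_mul.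
move=> c _ Ic [n [a [b [Ja Lb ->]]]]; rewrite mulr_sumr.
apply: sub_sum => [|i _]; first exact/submodule_mul/submodule_mul.
by rewrite mulrA; apply: ideal_mulI => //; apply: ideal_mulI.
Qed.

Lemma ideal_ringR : is_ideal OK.
Proof.
split=> //; first by exists 1; rewrite ?oner_eq0.
by exists 1; rewrite ?oner_eq0 // => x; rewrite tofrac1 mul1r.
Qed.
Hint Resolve ideal_ringR : core.

Lemma ideal_of_integral I : is_submodule I -> I `<=` OK ->
  (exists2 x, I x & x != 0) -> is_ideal I.
Proof.
move=> sI IR nI; split=> //; exists 1; first by rewrite oner_eq0.
by move=> x /IR; rewrite tofrac1 mul1r.
Qed.

Lemma ideal_mul_ideal I J : is_ideal I -> is_ideal J -> is_ideal (ideal_mul I J).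
Proof.
move=> [sI [x Ix x0] [d d0 Id]] [sJ [y Jy y0] [e e0 Je]]; split=> //.
- exact: submodule_mul.
- by exists (x * y); [exact: ideal_mulI|rewrite mulf_neq0].
- exists (d * e); first by rewrite mulf_neq0.
  move=> _ [n [a [b [Ia Jb ->]]]]; rewrite mulr_sumr; apply: sub_sum => // i _.
  by rewrite tofracM mulrACA; apply: ringRM; [apply: Id|apply: Je].
Qed.

Lemma colon_submodule I J : is_submodule J -> is_submodule (colon J I).
Proof.
move=> sJ; split.
- by move=> y _; rewrite mul0r; apply: sub0.
- by move=> x y hx hy z Iz; rewrite mulrDl; apply: subD; [|apply: hx|apply: hy].
- by move=> r x hx z Iz; rewrite -mulrA; apply: subM => //; apply: hx.
Qed.

Lemma colon_ideal I J : is_ideal I -> is_ideal J -> is_ideal (colon J I).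
Proof.
move=> [sI [x Ix x0] [d d0 Id]] [sJ [y Jy y0] [e e0 Je]]; split.
- exact: colon_submodule.
- exists (d%:F * y); last by rewrite mulf_neq0 // tofrac_eq0.
  by move=> z Iz; rewrite mulrAC; apply: subMR => //; apply: Id.
- have [n [m [m0 ex]]] := fraction_numden x.
  have n0 : n != 0.
    by apply: contra_neq x0; rewrite ex => ->; rewrite tofrac0 mul0r.
  (* Since [n = m x] with [x] in [I], every [z] in [(J : I)] satisfies [e n z = m e (z x)], which
     lies in [R]. *)
  exists (e * n); first by rewrite mulf_neq0.
  move=> z Jz; rewrite tofracM.
  have -> : n%:F = m%:F * x by rewrite ex mulrCA divff ?mulr1 ?tofrac_eq0.
  have -> : e%:F * (m%:F * x) * z = m%:F * (e%:F * (z * x)) by ring.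
  by apply: ringRM => //; apply/Je/Jz.
Qed.

Lemma scale_ideal (c : K) I : c != 0 -> is_ideal I ->
  is_ideal [set c * x | x in I].
Proof.
move=> c0 [sI [x Ix x0] [d d0 Id]]; split.
- split; first by exists 0; [apply: sub0|rewrite mulr0].
    move=> _ _ [y Iy <-] [z Iz <-].
    by exists (y + z); [apply: subD|rewrite mulrDr].
  move=> r _ [y Iy <-]; exists (r%:F * y); first exact: subM.
  by rewrite mulrCA.
- by exists (c * x); [exists x|rewrite mulf_neq0].
- have [n [m [m0 ec]]] := fraction_numden c.
  exists (d * m); first by rewrite mulf_neq0.
  move=> _ [y Iy <-]; rewrite tofracM.
  have -> : d%:F * m%:F * (c * y) = (c * m%:F) * (d%:F * y) by ring.
  have -> : c * m%:F = n%:F by rewrite ec divfK ?tofrac_eq0.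
  by apply: ringRM => //; apply: Id.
Qed.

(** * Sums of ideals and finitely generated ideals *)

Definition addI I J : set K := [set z | exists x y, [/\ I x, J y & z = x + y]].

Lemma addI_l I J : is_submodule J -> I `<=` addI I J.
Proof. by move=> sJ x Ix; exists x, 0; split; rewrite ?addr0 //; apply: sub0. Qed.

Lemma addI_r I J : is_submodule I -> J `<=` addI I J.
Proof. by move=> sI x Ix; exists 0, x; split; rewrite ?add0r //; apply: sub0. Qed.

Lemma addI_min I J L : is_submodule L -> I `<=` L -> J `<=` L -> addI I J `<=` L.
Proof. by move=> sL IL JL _ [x [y [/IL Lx /JL Ly ->]]]; apply: subD. Qed.

Lemma addI_submodule I J :
  is_submodule I -> is_submodule J -> is_submodule (addI I J).
Proof.
move=> sI sJ; split.
- by apply: addI_l => //; apply: sub0.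
- move=> _ _ [x [y [Ix Jy ->]]] [z [t [Iz Jt ->]]].
  by exists (x + z), (y + t); split; [apply: subD|apply: subD|rewrite addrACA].
- move=> r _ [x [y [Ix Jy ->]]].
  by exists (r%:F * x), (r%:F * y); split; [apply: subM|apply: subM|rewrite mulrDr].
Qed.

Lemma addI_ideal I J : is_ideal I -> is_ideal J -> is_ideal (addI I J).
Proof.
move=> [sI [x Ix x0] [d d0 Id]] [sJ [y Jy y0] [e e0 Je]]; split.
- exact: addI_submodule.
- by exists x => //; apply: addI_l.
- exists (d * e); first by rewrite mulf_neq0.
  move=> _ [z [t [/Id Iz /Je Jt ->]]]; rewrite tofracM mulrDr.
  apply: subD => //; last by rewrite -mulrA; apply: ringRM.
  by rewrite mulrAC mulrC; apply: ringRM.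
Qed.

(** Any finite type may index the generators, so that families over [unit], [bool], options,
    disjoint sums and tagged pairs need no renumbering. *)
Definition Rspan (T : finType) (g : T -> K) : set K :=
  [set x | exists a : T -> R, x = \sum_i (a i)%:F * g i].

Lemma Rspan_mem (T : finType) (g : T -> K) i : Rspan g (g i).
Proof.
exists (fun j => (j == i)%:R); rewrite (bigD1 i) //= eqxx tofrac1 mul1r big1 ?addr0 //.
by move=> j /negbTE ->; rewrite tofrac0 mul0r.
Qed.

Lemma Rspan_min (T : finType) (g : T -> K) L : is_submodule L ->
  (forall i, L (g i)) -> Rspan g `<=` L.
Proof. by move=> sL Lg x [a ->]; apply: sub_sum => // i _; apply: subM. Qed.

Lemma Rspan_submodule (T : finType) (g : T -> K) : is_submodule (Rspan g).
Proof.
split.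
- by exists (fun=> 0); rewrite big1 // => i _; rewrite tofrac0 mul0r.
- move=> _ _ [a ->] [b ->]; exists (fun i => a i + b i).
  by rewrite -big_split; apply: eq_bigr => i _; rewrite tofracD mulrDl.
- move=> r _ [a ->]; exists (fun i => r * a i).
  by rewrite mulr_sumr; apply: eq_bigr => i _; rewrite tofracM mulrA.
Qed.

Lemma common_denominator (T : finType) (g : T -> K) :
  exists2 d : R, d != 0 & forall i, OK (d%:F * g i).
Proof.
have [d dP] := choice (fun i => fraction_numden (g i)).
have [e eP] := choice dP.
exists (\prod_i e i); first by apply/prodf_neq0 => i _; case: (eP i).
move=> i; rewrite (bigD1 i) //=; have [ei0 ->] := eP i.
rewrite tofracM mulrAC mulrCA mulfV ?tofrac_eq0 // mulr1.
by apply: ringRM.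
Qed.

Lemma Rspan_fg (T : finType) (g : T -> K) (i : T) :
  g i != 0 -> is_fg_ideal (Rspan g).
Proof.
move=> gi0; split.
- split; [exact: Rspan_submodule | by exists (g i) => //; exact: Rspan_mem|].
  have [d d0 dP] := common_denominator g; exists d => // x [a ->].
  by rewrite mulr_sumr; apply: sub_sum => // j _; rewrite mulrCA; apply: ringRM.
- exists #|T|, (fun j => g (enum_val j)); apply/seteqP; split => _ [a ->].
    exists (fun j => a (enum_val j)).
    by rewrite (reindex _ (onW_bij _ (enum_val_bij T))).
  exists (fun j => a (enum_rank j)).
  rewrite (reindex _ (onW_bij _ (enum_rank_bij T))).
  by apply: eq_bigr => j _; rewrite enum_rankK.
Qed.

Lemma fg_ideal I : is_fg_ideal I -> is_ideal I. Proof. by case. Qed.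
Hint Resolve fg_ideal : core.

Lemma fg_span I : is_fg_ideal I -> exists n (g : 'I_n -> K), I = Rspan g.
Proof. by case=> _ [n [g ->]]; exists n, g. Qed.

(** A nonzero element of [I] is added as a generator, because the family [g] may be empty or zero
    while an ideal has to be nonzero. *)
Lemma fg_cover (T : finType) (g : T -> K) I : is_ideal I ->
  (forall i, I (g i)) -> exists J, [/\ is_fg_ideal J, J `<=` I & forall i, J (g i)].
Proof.
move=> [sI [x Ix x0] _] Ig.
pose h (i : option T) := oapp g x i.
exists (Rspan h); split; first exact: (@Rspan_fg _ h None).
  by apply: Rspan_min => // -[].
by move=> i; apply: (Rspan_mem h (Some i)).
Qed.

Lemma addI_fg I J : is_fg_ideal I -> is_fg_ideal J -> is_fg_ideal (addI I J).
Proof.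
move=> fI fJ; have [n [g eI]] := fg_span fI; have [m [h eJ]] := fg_span fJ.
have := addI_ideal (fg_ideal fI) (fg_ideal fJ).
move: fI fJ => /fg_ideal/ideal_sub sI /fg_ideal/ideal_sub sJ iIJ.
pose k (i : 'I_n + 'I_m) := match i with inl i => g i | inr i => h i end.
have [|L [fL LIJ Lk]] := @fg_cover _ k _ iIJ.
  case=> i /=.
    by apply: addI_l => //; rewrite eI; apply: Rspan_mem.
  by apply: addI_r => //; rewrite eJ; apply: Rspan_mem.
suff -> : addI I J = L by [].
apply/seteqP; split=> //; apply: addI_min; [by auto|rewrite eI|rewrite eJ].
  by apply: Rspan_min => [|i]; [auto|exact: (Lk (inl i))].
by apply: Rspan_min => [|i]; [auto|exact: (Lk (inr i))].
Qed.

Lemma ringR_fg : is_fg_ideal OK.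
Proof.
pose g (i : unit) : K := 1.
suff -> : OK = Rspan g by apply: (@Rspan_fg _ g tt); rewrite oner_eq0.
apply/seteqP; split; last by apply: Rspan_min => //.
move=> _ [r _ <-]; exists (fun=> r).
by rewrite (bigD1 tt) //= big1 ?mulr1 ?addr0 // => -[].
Qed.

Lemma principal_fg x : x != 0 -> is_fg_ideal [set r%:F * x | r in [set: R]].
Proof.
move=> x0; pose g (i : unit) := x.
suff -> : [set r%:F * x | r in [set: R]] = Rspan g by exact: (@Rspan_fg _ g tt).
apply/seteqP; split.
  by move=> _ [r _ <-]; exists (fun=> r); rewrite (bigD1 tt) //= big1 ?addr0 // => -[].
by move=> _ [a ->]; exists (a tt) => //; rewrite (bigD1 tt) //= big1 ?addr0 // => -[].
Qed.

(** Each generator of [J] lies in some member of the chain, and the largest of these finitely many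
    members contains [J]. *)
Lemma fg_sub_chain (F : set (set K)) J : is_fg_ideal J ->
  (exists X, F X) -> (forall X, F X -> is_submodule X) ->
  (forall X Y, F X -> F Y -> X `<=` Y \/ Y `<=` X) ->
  J `<=` \bigcup_(X in F) X -> exists2 X, F X & J `<=` X.
Proof.
move=> fJ [X0 FX0] sF tF JF; have [n [g eJ]] := fg_span fJ.
suff [X FX Xg] : exists2 X, F X & forall i, i \in enum 'I_n -> X (g i).
  exists X => //; rewrite eJ; apply: Rspan_min; first exact: sF.
  by move=> i; apply: Xg; rewrite mem_enum.
elim: (enum 'I_n) => [|i s [X FX Xs]]; first by exists X0.
have [Y FY Yi] : (\bigcup_(X in F) X) (g i) by apply: JF; rewrite eJ; apply: Rspan_mem.
have [XY|YX] := tF _ _ FX FY.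
  by exists Y => // j; rewrite inE => /predU1P[->|/Xs/XY].
by exists X => // j; rewrite inE => /predU1P[->|/Xs//]; apply: YX.
Qed.

Lemma fg_bigcover (T : finType) (L : T -> set K) I : is_ideal I ->
  (forall i, is_fg_ideal (L i) /\ L i `<=` I) ->
  exists J, [/\ is_fg_ideal J, J `<=` I & forall i, L i `<=` J].
Proof.
move=> iI LI.
have /choice[m mP] : forall i, exists p : {m : nat & 'I_m -> K}, L i = Rspan (projT2 p).
  by move=> i; have [/fg_span[n [g e]] _] := LI i; exists (existT _ n g).
pose g (p : {i : T & 'I_(projT1 (m i))}) := projT2 (m (tag p)) (tagged p).
have [|J [fJ JI Jg]] := @fg_cover _ g _ iI.
  by move=> [i j]; have [_] := LI i; apply; rewrite mP; apply: Rspan_mem.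
exists J; split=> // i; rewrite mP; apply: Rspan_min; first by auto.
by move=> j; apply: (Jg (Tagged (fun i => 'I_(projT1 (m i))) j)).
Qed.

(** Only finitely many elements of [J] occur when the generators of [L] are written as sums of
    products; [H] is built from these. *)
Lemma fg_sub_mul I J L : is_submodule I -> is_ideal J -> is_fg_ideal L ->
  L `<=` ideal_mul I J ->
  exists H, [/\ is_fg_ideal H, H `<=` J & L `<=` ideal_mul I H].
Proof.
move=> sI iJ fL LIJ; have [n [g eL]] := fg_span fL.
have /choice[H HP] : forall i, exists H,
    [/\ is_fg_ideal H, H `<=` J & ideal_mul I H (g i)].
  move=> i; have [m [a [b [Ia Jb e]]]] : ideal_mul I J (g i).
    by apply: LIJ; rewrite eL; apply: Rspan_mem.
  have [H [fH HJ Hb]] := fg_cover iJ Jb.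
  by exists H; split=> //; exists m, a, b.
have [|H' [fH' H'J HH']] := @fg_bigcover _ H _ iJ.
  by move=> i; case: (HP i).
exists H'; split=> //; rewrite eL; apply: Rspan_min => [|i]; first exact: submodule_mul.
by have [_ _] := HP i; apply: ideal_mulSS.
Qed.

End FractionalIdeals.

(** * Star operations and localization *)

Section StarOperation.
Variables (R : idomainType) (star : operation R).
Hypotheses (star_op : is_star_operation star) (star_ft : finite_type star).
Local Notation K := {fraction R}.
Local Notation OK := (@ringR R).
Implicit Types (I J L M N : set K) (x y z : K) (r s d : R).

Hint Resolve ideal_sub ringR_submodule ringR1 ringR_tofrac : core.
Hint Resolve ideal_ringR fg_ideal submodule_mul : core.

Lemma star_integral I : is_ideal I -> I `<=` OK -> star I `<=` OK.
Proof. by move=> iI IR; rewrite -(star_ring star_op); apply: star_mono. Qed.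

(** Apply [star] to the inclusion of [x I] in [L^*] and use idempotence. The scaling axiom requires
    [x] to be nonzero, so [x = 0] is treated apart. *)
Lemma star_mulr I L x : is_ideal I -> is_ideal L ->
  (forall y, I y -> star L (x * y)) -> forall y, star I y -> star L (x * y).
Proof.
move=> iI iL h y Iy; have iL' := star_ideal star_op iL.
have [->|x0] := eqVneq x 0; first by rewrite mul0r; apply: sub0; auto.
rewrite -(star_idem star_op iL).
have : star [set x * z | z in I] (x * y) by rewrite star_scale //; exists y.
apply: star_mono => //; first exact: scale_ideal.
by move=> _ [z Iz <-]; apply: h.
Qed.

Lemma star_fgP I x : is_ideal I -> star I x ->
  exists J, [/\ is_fg_ideal J, J `<=` I & star J x].
Proof. by move=> iI; rewrite star_ft // => -[J [fJ JI] Jx]; exists J. Qed.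

(** By finite type [x] is in the closure of a finitely generated ideal inside the union, and that
    ideal lies in one member of the chain. *)
Lemma star_chain (F : set (set K)) x :
  (exists X, F X) -> (forall X, F X -> is_ideal X) ->
  (forall X Y, F X -> F Y -> X `<=` Y \/ Y `<=` X) ->
  is_ideal (\bigcup_(X in F) X) -> star (\bigcup_(X in F) X) x ->
  exists2 X, F X & star X x.
Proof.
move=> nF iF tF iU /(star_fgP iU)[J [fJ JU Jx]].
have [|X FX JX] := fg_sub_chain fJ nF _ tF JU; first by move=> X /iF; auto.
by exists X => //; apply: star_mono Jx; auto.
Qed.

(** * Existence and primeness of *-maximal ideals *)

Lemma proper_star_ideal1 M : proper_star_ideal star M -> ~ M 1.
Proof.
case=> iM MR neM _ M1; apply: neM; apply/seteqP; split=> // x Rx.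
by rewrite -[x]mulr1; apply: subMR; auto.
Qed.

Lemma star_Max_exists I : is_ideal I -> I `<=` OK -> ~ star I 1 ->
  exists2 M, star_Max star M & I `<=` M.
Proof.
move=> iI IR I1.
pose P : set (set K) := [set X | X = set0 \/ proper_star_ideal star X /\ I `<=` X].
have PI : P (star I).
  right; split; last exact: star_ext.
  split; [exact: star_ideal|exact: star_integral| |exact: star_idem].
  by move=> e; apply: I1; rewrite e.
have [F FP totF|M [PM maxM]] := @Zorn_bigcup _ P.
  have [[X0 [FX0 X0n]]|F0] := pselect (exists X, F X /\ X <> set0); last first.
    left; apply/seteqP; split=> // x [X FX Xx].
    by have [X0|/eqP/set0P[]] := pselect (X = set0); [rewrite X0 in Xx|
      move=> y Xy; apply: F0; exists X; split=> // e; rewrite e in Xy].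
  pose G := [set X | F X /\ X <> set0].
  have GP X : G X -> proper_star_ideal star X /\ I `<=` X.
    by case=> /FP[] // ->.
  have -> : \bigcup_(X in F) X = \bigcup_(X in G) X.
    apply/seteqP; split=> x [X FX Xx]; exists X => //; last by case: FX.
    by split=> // e; rewrite e in Xx.
  have GX0 : G X0 by split.
  have nG : exists X, G X by exists X0.
  have iG X : G X -> is_ideal X by move=> /GP[[]].
  have tG X Y : G X -> G Y -> X `<=` Y \/ Y `<=` X by move=> [FX _] [FY _]; apply: totF.
  have IU : I `<=` \bigcup_(X in G) X.
    by move=> x Ix; exists X0 => //; have [_] := GP X0 GX0; apply.
  have UR : \bigcup_(X in G) X `<=` OK by move=> x [X /GP[[_ XR _ _] _] /XR].
  have iU : is_ideal (\bigcup_(X in G) X).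
    apply: ideal_of_integral => //; last first.
      by case: (iI) => _ [x /IU Ux x0] _; exists x.
    split.
    - by exists X0 => //; apply: sub0; auto.
    - move=> x y [X GX Xx] [Y GY Yy]; have [XY|YX] := tG _ _ GX GY.
        by exists Y => //; apply: subD; auto.
      by exists X => //; apply: subD; auto.
    - by move=> r x [X GX Xx]; exists X => //; apply: subM; auto.
  right; split=> //; split=> //.
    move=> e; have [X GX] : (\bigcup_(X in G) X) 1 by rewrite e.
    by apply: proper_star_ideal1; have [] := GP X GX.
  apply/seteqP; split; last exact: star_ext.
  move=> x /(star_chain nG iG tG iU)[X GX]; exists X => //.
  by have [[_ _ _ <-]] := GP X GX.
have M0 : M <> set0.
  move=> M0; apply: (maxM (star I)) => //; rewrite M0; split=> // h.
  suff : (set0 : set K) 0 by [].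
  by apply: h; apply: sub0; apply: ideal_sub; apply: star_ideal.
case: PM => // -[pM IM]; exists M => //; split=> // N pN MN.
apply/seteqP; split=> //; apply: contrapT => NM.
by apply: (maxM N) => //; right; split=> //; apply: subset_trans MN.
Qed.

Lemma star1_of_Max I : is_ideal I -> I `<=` OK ->
  (forall M, star_Max star M -> ~ I `<=` M) -> star I 1.
Proof.
move=> iI IR h; apply: contrapT => /(star_Max_exists iI IR)[M MM].
exact: h.
Qed.

Lemma star1_ring I : is_ideal I -> I `<=` OK -> star I 1 -> star I = OK.
Proof.
move=> iI IR I1; apply/seteqP; split; first exact: star_integral.
move=> x Rx; rewrite -[x]mulr1.
by apply: subMR => //; apply/ideal_sub/star_ideal.
Qed.

Section AtMaximal.
Variable M : set K.
Hypothesis MM : star_Max star M.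

Lemma Max_ideal : is_ideal M. Proof. by case: MM => -[]. Qed.
Lemma Max_sub : is_submodule M. Proof. by case: Max_ideal. Qed.
Lemma Max_integral : M `<=` OK. Proof. by case: MM => -[]. Qed.
Lemma Max1 : ~ M 1. Proof. by apply: proper_star_ideal1; case: MM. Qed.
Lemma Max_star : star M = M. Proof. by case: MM => -[]. Qed.
Lemma Max_neq0 s : ~ M s%:F -> s != 0.
Proof.
by move=> Ms; apply/eqP => s0; apply: Ms; rewrite s0 tofrac0; exact: sub0 Max_sub.
Qed.

Lemma Max_star1 I : is_ideal I -> star I 1 -> ~ I `<=` M.
Proof.
move=> iI I1 IM; apply: Max1; rewrite -Max_star.
by apply: star_mono I1 => //; exact: Max_ideal.
Qed.

(** A *-maximal ideal above [M + x R] would equal [M] by maximality and so contain [x]. *)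
Lemma Max_adjoin x : OK x -> ~ M x ->
  star (addI M [set r%:F * x | r in [set: R]]) 1.
Proof.
move=> Rx nMx.
have x0 : x != 0 by apply/eqP => x0; apply: nMx; rewrite x0; apply: sub0 Max_sub.
have ix := fg_ideal (principal_fg x0).
have MN := addI_l (I := M) (ideal_sub ix).
apply: contrapT => /star_Max_exists[||N' [pN' _] NN'].
- by apply: addI_ideal => //; apply: Max_ideal.
- by apply: addI_min => //; [exact: Max_integral|move=> _ [r _ <-]; apply: ringRM].
have eN : N' = M by have [_ h] := MM; apply: h => //; apply: subset_trans NN'.
apply: nMx; rewrite -eN; apply: NN'; apply: addI_r; first exact: Max_sub.
by exists 1; rewrite ?tofrac1 ?mul1r.
Qed.

(** If [x] is not in [M], then [y] multiplies [M + x R] into [M], hence also its closure, which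
    contains [1]. *)
Lemma Max_prime x y : OK x -> OK y -> M (x * y) -> M x \/ M y.
Proof.
move=> Rx Ry Mxy; have [Mx|nMx] := pselect (M x); [by left|right].
have x0 : x != 0 by apply/eqP => x0; apply: nMx; rewrite x0; apply: sub0 Max_sub.
have iN := addI_ideal Max_ideal (fg_ideal (principal_fg x0)).
rewrite -[y]mulr1 -Max_star.
apply: (star_mulr iN Max_ideal _ (Max_adjoin Rx nMx)) => z.
rewrite Max_star => -[a [_ [Ma [r _ <-] ->]]]; rewrite mulrDr; apply: (subD Max_sub).
  exact: subMR Max_sub _ _.
by rewrite mulrCA [y * x]mulrC; apply: subM Max_sub _.
Qed.

Lemma Max_primeR r s : ~ M r%:F -> ~ M s%:F -> ~ M (r * s)%:F.
Proof. by move=> nr ns; rewrite tofracM => /Max_prime[] //; exists r || exists s. Qed.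

Lemma Max_prod (T : Type) (t : seq T) (P : pred T) (f : T -> R) :
  (forall i, P i -> ~ M (f i)%:F) -> ~ M (\prod_(i <- t | P i) f i)%:F.
Proof.
move=> h; elim/big_ind: _ => //; last exact: Max_primeR.
by rewrite tofrac1; exact: Max1.
Qed.

End AtMaximal.

(** This is [I R_M] written with a single denominator; for a submodule [I] and a *-maximal [M] it
    agrees with the product of [I] and [localization M]. *)
Definition loc M I : set K := [set x | exists2 s : R, ~ M s%:F & I (s%:F * x)].

Lemma loc_mono M I J : I `<=` J -> loc M I `<=` loc M J.
Proof. by move=> IJ x [s Ms /IJ]; exists s. Qed.

Section Localization.
Variable M : set K.
Hypothesis MM : star_Max star M.

Lemma loc_sub I : I `<=` loc M I.
Proof. by move=> x Ix; exists 1; rewrite tofrac1 ?mul1r //; apply: Max1. Qed.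

Lemma loc_mul I x y : is_submodule I -> loc M OK x -> loc M I y -> loc M I (x * y).
Proof.
move=> sI [s Ms Rx] [t Mt Iy]; exists (s * t); first exact: Max_primeR.
by rewrite tofracM mulrACA; apply: subMR.
Qed.

Lemma loc_submodule I : is_submodule I -> is_submodule (loc M I).
Proof.
move=> sI; split; first by apply: loc_sub; apply: sub0.
- move=> x y [s Ms Ix] [t Mt Iy]; exists (s * t); first exact: Max_primeR.
  rewrite tofracM mulrDr; apply: subD => //; last by rewrite -mulrA; apply: subM.
  by rewrite mulrAC mulrC; apply: subM.
- by move=> r x Ix; apply: loc_mul => //; apply: loc_sub.
Qed.

Lemma loc_div I s x : ~ M s%:F -> loc M I (s%:F * x) -> loc M I x.
Proof.
move=> Ms [t Mt It]; exists (t * s); first exact: Max_primeR.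
by rewrite tofracM -mulrA.
Qed.

Lemma loc_max x : M x -> forall y, loc M OK y -> loc M M (x * y).
Proof.
move=> Mx y [s Ms Ry]; exists s => //.
by rewrite mulrCA mulrC; apply: subMR => //; apply: Max_sub.
Qed.

Lemma mul_localization I : is_submodule I -> ideal_mul I (localization M) = loc M I.
Proof.
move=> sI; apply/seteqP; split.
  apply: ideal_mul_min; first exact: loc_submodule.
  move=> x _ Ix [r [s [Ms ->]]]; apply: (loc_div Ms); apply: loc_sub.
  have -> : s%:F * (x * (r%:F / s%:F)) = s%:F / s%:F * (r%:F * x) by ring.
  by rewrite divff ?mul1r ?(tofrac_eq0, Max_neq0 MM) //; apply: subM.
move=> x [s Ms Isx].
have -> : x = s%:F * x * (1%:F / s%:F).
  by rewrite tofrac1 mul1r mulrAC divff ?mul1r // tofrac_eq0 (Max_neq0 MM).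
by apply: ideal_mulI => //; exists 1, s.
Qed.

(** The product of the denominators belonging to the generators of [J] serves for all of [J], and it
    avoids [M] because [M] is prime. *)
Lemma loc_fg I J x : is_fg_ideal J -> is_submodule I ->
  (forall y, J y -> loc M I (x * y)) ->
  exists2 s, ~ M s%:F & forall y, J y -> I (s%:F * x * y).
Proof.
move=> fJ sI JI; have [n [g eJ]] := fg_span fJ.
have /choice[t tP] : forall i, exists s, ~ M s%:F /\ I (s%:F * (x * g i)).
  by move=> i; have [|s] := JI (g i); [rewrite eJ; apply: Rspan_mem|exists s].
exists (\prod_i t i); first by apply: Max_prod => // i _; case: (tP i).
rewrite eJ => _ [a ->]; rewrite mulr_sumr; apply: sub_sum => // i _.
rewrite mulrCA; apply: subM => //; rewrite (bigD1 i) //= [t i * _]mulrC tofracM.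
set P := \prod_(j | _) _.
have -> : P%:F * (t i)%:F * x * g i = P%:F * ((t i)%:F * (x * g i)) by ring.
by apply: subM => //; case: (tP i).
Qed.

End Localization.

Lemma tildeP I x : is_submodule I ->
  tilde star I x <-> forall M, star_Max star M -> loc M I x.
Proof.
by move=> sI; split=> h M MM; have := h M MM; rewrite mul_localization.
Qed.

Lemma tilde_sub I : is_submodule I -> I `<=` tilde star I.
Proof. by move=> sI x Ix; apply/(tildeP _ sI) => M MM; apply: loc_sub. Qed.

Lemma tilde_loc I M : is_submodule I -> star_Max star M -> tilde star I `<=` loc M I.
Proof. by move=> sI MM x /(tildeP _ sI); apply. Qed.

Lemma tilde_submodule I : is_submodule I -> is_submodule (tilde star I).
Proof.
move=> sI; split; first by apply: tilde_sub => //; apply: sub0.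
- move=> x y /(tildeP _ sI) hx /(tildeP _ sI) hy; apply/(tildeP _ sI) => M MM.
  by apply: subD (loc_submodule _ _) (hx _ MM) (hy _ MM).
- move=> r x /(tildeP _ sI) hx; apply/(tildeP _ sI) => M MM.
  by apply: subM (loc_submodule _ _) (hx _ MM).
Qed.

(** The ideal [D] of denominators of [x] lies in no *-maximal ideal, so [1] is in [D^*], and [x]
    multiplies [D^*] into [R^* = R]. *)
Lemma ringR_of_loc x : (forall M, star_Max star M -> loc M OK x) -> OK x.
Proof.
move=> hx; pose D := OK `&` [set y | OK (x * y)].
have [n [d [d0 ex]]] := fraction_numden x.
have iD : is_ideal D.
  apply: ideal_of_integral; last 2 first.
  - by move=> y [].
  - exists d%:F; last by rewrite tofrac_eq0.
    by split=> //; rewrite /= ex divfK // tofrac_eq0.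
  split; first by split; rewrite /= ?mulr0; apply: sub0.
  - move=> y z [Ry Dy] [Rz Dz]; split; first exact: subD.
    by rewrite /= mulrDr; apply: subD.
  - move=> r y [Ry Dy]; split; first exact: subM.
    by rewrite /= mulrCA; apply: subM.
have D1 : star D 1.
  apply: star1_of_Max => // [y []//|M MM DM].
  by have [s Ms Rs] := hx _ MM; apply: Ms; apply: DM; split=> //=; rewrite mulrC.
rewrite -[x]mulr1 -(star_ring star_op).
by apply: (star_mulr iD _ _ D1) => // y [_ /=]; rewrite star_ring.
Qed.

End StarOperation.

(** * Integral elements and finitely generated ideals *)

Section Integrality.
Variable R : idomainType.
Local Notation K := {fraction R}.
Local Notation OK := (@ringR R).
Implicit Types (I J : set K) (x y : K).

Lemma fg_gen_neq0 n (g : 'I_n -> K) : is_fg_ideal (Rspan g) -> exists i, g i != 0.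
Proof.
move=> [[_ [x [a ->] /eqP x0] _] _]; apply: contrapT => h; apply: x0.
rewrite big1 // => i _; have [->|gi0] := eqVneq (g i) 0; first by rewrite mulr0.
by case: h; exists i.
Qed.

(** The generators of [I] form an eigenvector with eigenvalue [x] of a matrix over [R], so [x] is a
    root of its characteristic polynomial. *)
Lemma integral_of_fg I x : is_fg_ideal I -> (forall y, I y -> I (x * y)) ->
  integralOver (@tofrac R) x.
Proof.
move=> fI xI; have [n [g eI]] := fg_span fI; rewrite eI in fI xI.
have /choice[a aP] : forall i, exists a, x * g i = \sum_j (a j)%:F * g j.
  by move=> i; apply: xI; apply: Rspan_mem.
(* The matrix is transposed because eigenvectors are rows. *)
pose A : 'M[R]_n := \matrix_(i, j) a j i.
exists (char_poly A); first exact: char_poly_monic.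
rewrite map_char_poly -eigenvalue_root_char; apply/eigenvalueP.
exists (\row_i g i).
  apply/rowP => i; rewrite !mxE aP; apply: eq_bigr => j _.
  by rewrite !mxE mulrC.
have [i gi0] := fg_gen_neq0 fI.
by apply: contra_neq gi0 => /rowP/(_ i); rewrite !mxE.
Qed.

(** [J] is spanned by the powers of [x] below the degree of a monic equation; the equation itself
    rewrites the next power. *)
Lemma fg_of_integral x : integralOver (@tofrac R) x ->
  exists2 J, is_fg_ideal J & forall y, J y -> J (x * y).
Proof.
case=> p mp rx; have sp0 : (0 < size p)%N by rewrite size_poly_gt0 monic_neq0.
have [n en] : exists n, size p = n.+1 by exists (size p).-1; rewrite prednK.
have xn : x ^+ n = - \sum_(i < n) (p`_i)%:F * x ^+ i.
  move: rx; rewrite /root (@horner_coef_wide _ n.+1); last by rewrite -en size_poly.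
  rewrite big_ord_recr /= coef_map /=.
  have -> : p`_n = 1 by move/monicP: mp; rewrite lead_coefE en.
  rewrite tofrac1 mul1r addrC addr_eq0 => /eqP ->; congr (- _).
  by apply: eq_bigr => i _; rewrite coef_map.
(* A monic constant is [1] and has no root. *)
case: n => [|n] in en xn.
  by move/eqP: xn; rewrite big_ord0 oppr0 oner_eq0.
pose g (i : 'I_n.+1) := x ^+ i.
have sg := Rspan_submodule g.
exists (Rspan g); first by apply: (@Rspan_fg _ _ g ord0); rewrite oner_eq0.
move=> _ [a ->]; rewrite mulr_sumr; apply: sub_sum => // i _.
rewrite mulrCA; apply: subM => //; rewrite -exprS.
have [ltin|] := ltnP i.+1 n.+1; first exact: (Rspan_mem g (Ordinal ltin)).
rewrite ltnS => leni; have -> : i.+1 = n.+1.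
  by congr _.+1; apply/eqP; rewrite eqn_leq leni -ltnS ltn_ord.
rewrite xn; apply: subN => //; apply: sub_sum => // j _.
by apply: subM => //; apply: (Rspan_mem g j).
Qed.

End Integrality.

(** * Prüfer *-multiplication domains *)

Section StarMultiplication.
Variables (R : idomainType) (star : operation R).
Hypotheses (star_op : is_star_operation star) (star_ft : finite_type star).
Local Notation K := {fraction R}.
Local Notation OK := (@ringR R).
Implicit Types (I J L M N Q : set K) (x y z : K) (r s d : R).

Hint Resolve ideal_sub ringR_submodule ringR1 ringR_tofrac : core.
Hint Resolve ideal_ringR fg_ideal submodule_mul tilde_submodule loc_submodule : core.

(* Modulo [M] the matrix is [s] times the identity, so its determinant is
   congruent to a power of [s]. *)
Lemma det_notin_Max M n (A : 'M[R]_n) s : star_Max star M -> ~ M s%:F ->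
  (forall i j, M (s *+ (i == j) - A i j)%:F) -> ~ M (\det A)%:F.
Proof.
move=> MM Ms MA; have sM := Max_sub MM.
have MR x r : M x -> M (x * r%:F) by move=> Mx; rewrite mulrC; apply: subM.
rewrite /determinant (bigD1 (1%g : 'S_n)) //= tofracD odd_perm1 expr0 mul1r.
set S := \sum_(i | _) _ => MD.
have : ~ M (\prod_i A i ((1%g : 'S_n) i))%:F.
  apply: (Max_prod star_op star_ft MM) => i _.
  move=> MAii; apply: Ms; have := subD sM (MA i i) MAii.
  by rewrite perm1 eqxx mulr1n tofracB subrK.
apply; rewrite -[X in M X](addrK S%:F).
apply: subD => //; apply: subN => //; rewrite /S rmorph_sum; apply: sub_sum => // t t1.
(* A permutation other than the identity moves some [i], so its term has an off-diagonal factor,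
   which lies in [M]. *)
have [i ti] : exists i, t i != i.
  apply: contrapT => h; move/eqP: t1; apply; apply/permP => i; rewrite perm1.
  by apply/eqP; apply: contrapT => /negP ti; apply: h; exists i.
rewrite rmorphM /= mulrC; apply/MR; rewrite (bigD1 i) //= rmorphM; apply: MR.
have := subN sM (MA i (t i)).
by rewrite eq_sym (negbTE ti) mulr0n sub0r tofracN opprK.
Qed.

(** Otherwise the generators of [I] solve a linear system whose matrix is [s] times the identity
    modulo [M]. They are not all zero, so the determinant is [0], although it has to lie outside
    [M]. *)
Lemma nakayama M I Q s : star_Max star M -> is_fg_ideal I -> Q `<=` M ->
  ~ M s%:F -> ~ (forall y, I y -> ideal_mul I Q (s%:F * y)).
Proof.
move=> MM fI QM Ms sI; have sM := Max_sub MM.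
have [n [g eI]] := fg_span fI; rewrite eI in fI sI.
have IQ : ideal_mul (Rspan g) Q `<=` [set x | exists2 q : 'I_n -> R,
    forall i, M (q i)%:F & x = \sum_i (q i)%:F * g i].
  apply: ideal_mul_min.
    split.
    - exists (fun=> 0); first by move=> _; rewrite tofrac0; apply: sub0.
      by rewrite big1 // => i _; rewrite tofrac0 mul0r.
    - move=> _ _ [q Mq ->] [t Mt ->]; exists (fun i => q i + t i).
        by move=> i; rewrite tofracD; apply: subD.
      by rewrite -big_split; apply: eq_bigr => i _; rewrite tofracD mulrDl.
    - move=> r _ [q Mq ->]; exists (fun i => r * q i).
        by move=> i; rewrite tofracM; apply: subM.
      by rewrite mulr_sumr; apply: eq_bigr => i _; rewrite tofracM mulrA.
  move=> _ y [a ->] /QM My; have [r _ er] := Max_integral MM My.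
  exists (fun i => a i * r); first by move=> i; rewrite tofracM er; apply: subM.
  by rewrite mulr_suml; apply: eq_bigr => i _; rewrite tofracM er mulrAC.
have /choice[q qP] : forall i, exists q : 'I_n -> R,
    (forall j, M (q j)%:F) /\ s%:F * g i = \sum_j (q j)%:F * g j.
  by move=> i; have [q] := IQ _ (sI _ (Rspan_mem g i)); exists q.
pose A : 'M[R]_n := \matrix_(i, j) (s *+ (i == j) - q j i).
have /eqP detA : \det (map_mx (@tofrac R) A) == 0.
  apply/det0P; exists (\row_i g i).
    have [i gi0] := fg_gen_neq0 fI.
    by apply: contra_neq gi0 => /rowP/(_ i); rewrite !mxE.
  apply/rowP => i; rewrite !mxE.
  under eq_bigr do rewrite !mxE tofracB mulrBr.
  rewrite big_split /= sumrN (bigD1 i) //= eqxx mulr1n.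
  rewrite big1 ?addr0 => [|j /negbTE ->]; last by rewrite mulr0n tofrac0 mulr0.
  rewrite mulrC (qP i).2; apply/eqP; rewrite subr_eq0; apply/eqP.
  by apply: eq_bigr => j _; rewrite mulrC.
apply: (@det_notin_Max M n A s) => //.
  by move=> i j; rewrite mxE opprB addrC subrK; case: (qP j).
have -> : (\det A)%:F = 0 by rewrite -detA det_map_mx.
exact: sub0.
Qed.

(** At each *-maximal [M], some [s] outside [M] satisfies that [s x] maps [I] into itself; then
    [s x] is integral, hence in [R]. *)
Lemma ringR_of_tilde_stable I x : integrally_closed R -> is_fg_ideal I ->
  (forall y, I y -> tilde star I (x * y)) -> OK x.
Proof.
move=> icR fI xI; apply: (ringR_of_loc star_op star_ft) => M MM.
have [||s Ms sI] := @loc_fg _ _ star_op star_ft M MM I I x fI.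
- by auto.
- by move=> y /xI /(tilde_loc star_op star_ft (ideal_sub (fg_ideal fI)) MM).
by exists s => //; apply/icR/(integral_of_fg fI sI).
Qed.

(** An integral [x] stabilizes a finitely generated [J], hence every [J_M] and their intersection.
    The converse is the local argument above. *)
Lemma tilde_integrally_closed :
  star_integrally_closed (tilde star) <-> integrally_closed R.
Proof.
split=> [tc x /fg_of_integral[J fJ xJ]|icR].
  rewrite tc; exists J => //= y.
  have sJ := ideal_sub (fg_ideal fJ).
  move=> /(tildeP star_op star_ft _ sJ) yJ.
  apply/(tildeP star_op star_ft _ sJ) => M MM.
  by have [s Ms /xJ Js] := yJ _ MM; exists s => //; rewrite mulrCA.
apply/seteqP; split=> x.
  move=> Rx; exists OK; first exact: ringR_fg.
  by move=> y; apply: subMR; auto.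
move=> [J fJ xJ]; apply: (ringR_of_tilde_stable icR fJ) => y Jy.
by apply: xJ; apply: tilde_sub => //; auto.
Qed.

Lemma fg_sub_star I J : is_fg_ideal I -> is_ideal J -> I `<=` star J ->
  exists L, [/\ is_fg_ideal L, L `<=` J & I `<=` star L].
Proof.
move=> fI iJ IJ; have [n [g eI]] := fg_span fI.
have /choice[L LP] : forall i, exists L, [/\ is_fg_ideal L, L `<=` J & star L (g i)].
  by move=> i; apply: star_fgP => //; apply: IJ; rewrite eI; apply: Rspan_mem.
have [|L' [fL' L'J LL']] := @fg_bigcover _ _ L J iJ; first by move=> i; case: (LP i).
exists L'; split=> //; rewrite eI; apply: Rspan_min => [|i].
  by apply: ideal_sub; apply: star_ideal => //; auto.
by have [/fg_ideal iL _] := LP i; apply: star_mono => //; auto.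
Qed.

Lemma v_submodule I : is_submodule (v_op I).
Proof. by apply: colon_submodule. Qed.

Lemma v_integral I : I `<=` OK -> v_op I `<=` OK.
Proof.
move=> IR x vx; rewrite -[x]mulr1; apply: vx => y Iy; rewrite mul1r; exact: IR.
Qed.

Lemma clifford_PvMD :
  star_integrally_closed star -> clifford_regular star -> PvMD R.
Proof.
move=> icS cr I fI; have iI := fg_ideal fI; have sI := ideal_sub iI.
have [J iJ eIJ] := cr I iI; rewrite ideal_mulA // in eIJ.
set Q := ideal_mul I J in eIJ; have iQ : is_ideal Q by exact: ideal_mul_ideal.
(* Such an [x] also maps [I^*] into itself, so it belongs to [R^[*]]. *)
have stable x : (forall y, I y -> star I (x * y)) -> OK x.
  move=> xI; rewrite icS; exists I => //= y.
  exact: star_mulr.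
have QR : Q `<=` OK.
  move=> x Qx; apply: stable => y Iy; rewrite eIJ.
  apply: star_ext => //; first exact: ideal_mul_ideal.
  by rewrite mulrC; apply: ideal_mulI.
have JI : J `<=` colon OK I by move=> x Jx y Iy; rewrite mulrC; apply/QR/ideal_mulI.
(* Finite type replaces [Q] by a finitely generated [H]: [I] lies in [L^*] for some finitely
   generated [L] inside [I Q], and [L] lies in [I H]. *)
have [||L [fL LIQ IL]] := @fg_sub_star I (ideal_mul I Q) fI.
- by apply: ideal_mul_ideal.
- by rewrite -eIJ; apply: star_ext.
have [H [fH HQ LH]] := fg_sub_mul sI iQ fL LIQ.
(* If [x] is in [(R : H)], then [x I H] lies in [I], so [x] maps [I] into [I^*] and therefore lies
   in [R]. *)
have vH1 : v_op H 1.
  move=> x xH; rewrite mul1r; apply: stable => y /IL.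
  apply: star_mulr => //; first by auto.
  move=> z /LH Hz; apply: star_ext => //.
  have : ideal_mul I H z -> I (x * z); last exact.
  move: z {Hz}; apply: (@ideal_mul_min _ I H [set z | I (x * z)]).
    split; rewrite /= ?mulr0; first exact: sub0.
      by move=> a b; rewrite mulrDr; apply: subD.
    by move=> r a; rewrite mulrCA; apply: subM.
  by move=> a b Ia Hb /=; rewrite mulrCA mulrC; apply: subMR => //; apply: xH.
(* Being finitely generated with [1] in [H^v], the ideal [H] witnesses that the t-closure of
   [I (R : I)] is [R]. *)
have H_sub : H `<=` ideal_mul I (colon OK I) by apply: subset_trans HQ (ideal_mulSS _ _).
apply/seteqP; split.
  move=> x [L' [_ L'I]]; apply: v_integral.
  apply: (subset_trans L'I); apply: ideal_mul_min => // a b Ia; rewrite mulrC; exact.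
move=> x Rx; exists H; first by split.
rewrite -[x]mulr1.
exact: (subMR (@v_submodule H) Rx vH1).
Qed.

Lemma PstarMD_of_Max : (forall I M, is_fg_ideal I -> star_Max star M ->
  ~ ideal_mul I (colon OK I) `<=` M) -> PstarMD star.
Proof.
move=> h I fI; have iI := fg_ideal fI.
have IR : ideal_mul I (colon OK I) `<=` OK.
  by apply: ideal_mul_min => // a b Ia; rewrite mulrC; apply.
have iII : is_ideal (ideal_mul I (colon OK I)).
  by apply: ideal_mul_ideal => //; apply: colon_ideal.
apply: star1_ring => //; apply: star1_of_Max => // M; exact: h.
Qed.

Lemma PstarMD_notin_Max I M : PstarMD star -> is_fg_ideal I -> star_Max star M ->
  ~ ideal_mul I (colon OK I) `<=` M.
Proof.
move=> pmd fI MM; apply: (Max_star1 star_op MM); last by rewrite pmd.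
by apply: ideal_mul_ideal; [|apply: colon_ideal]; auto.
Qed.

Lemma clifford_PstarMD :
  integrally_closed R -> clifford_regular (tilde star) -> PstarMD star.
Proof.
move=> icR cr; apply: PstarMD_of_Max => I M fI MM IM.
have iI := fg_ideal fI; have sI := ideal_sub iI.
have [J iJ eIJ] := cr I iI; rewrite ideal_mulA // in eIJ.
set Q := ideal_mul I J in eIJ.
have QR : Q `<=` OK.
  move=> x Qx; apply: (ringR_of_tilde_stable icR fI) => y Iy; rewrite eIJ.
  by apply: tilde_sub; [..|rewrite mulrC; apply: ideal_mulI]; auto.
have QM : Q `<=` M.
  apply: subset_trans IM; apply: ideal_mulSS => // x Jx y Iy.
  by rewrite mulrC; apply/QR/ideal_mulI.
(* Taken with multiplier [1]: [I] lies in [(I Q)_M], so a single [s] outside [M] carries [I] into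
   [I Q], against Nakayama's lemma. *)
have [||s Ms sIQ] := @loc_fg _ _ star_op star_ft M MM (ideal_mul I Q) I 1 fI.
- by auto.
- move=> y Iy; rewrite mul1r; apply: (tilde_loc star_op star_ft) => //.
    by auto.
  by rewrite -eIJ; apply: tilde_sub.
by apply: (nakayama MM fI QM Ms) => y /sIQ; rewrite mulr1.
Qed.

(** If [y I] lies in [R], then so does [y I^*], because [R^* = R]. *)
Lemma star_sub_v I : is_ideal I -> star I `<=` v_op I.
Proof.
move=> iI x sx y yI; rewrite mulrC -(star_ring star_op).
by apply: star_mulr sx => // z Iz; rewrite star_ring //; apply: yI.
Qed.

(** For [J] finitely generated and [x] in [J^v], the ideal [x J (R : J)] lies in [J]; closing up
    gives [x] in [J^*]. *)
Lemma PstarMD_t I : PstarMD star -> is_ideal I -> star I = t_op I.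
Proof.
move=> pmd iI; rewrite star_ft //.
apply/seteqP; split=> x [J [fJ JI] Jx]; exists J => //.
  by apply: star_sub_v => //; auto.
have iJ := fg_ideal fJ.
have J1 : star (ideal_mul J (colon OK J)) 1 by rewrite pmd.
rewrite -[x]mulr1; apply: star_mulr J1 => //.
  by apply: ideal_mul_ideal => //; apply: colon_ideal.
move=> y Jy; apply: star_ext => //; move: y Jy.
apply: (@ideal_mul_min _ J _ [set y | J (x * y)]).
  split; rewrite /= ?mulr0; first by apply: sub0; auto.
    by move=> a b; rewrite mulrDr; apply: subD; auto.
  by move=> r a; rewrite mulrCA; apply: subM; auto.
by move=> a b Ja Jb /=; rewrite mulrCA mulrC; apply: subMR; auto.
Qed.

(** [star] and [t] have the same closed ideals, hence the same maximal ones, and these alone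
    determine the tilde operation. *)
Lemma PstarMD_w I : PstarMD star -> tilde star I = w_op I.
Proof.
move=> pmd; rewrite /w_op /tilde.
have pE M : proper_star_ideal star M = proper_star_ideal (@t_op R) M.
  by apply/propext; split=> -[iM MR nM eM]; split=> //;
    [rewrite -(PstarMD_t pmd iM)|rewrite (PstarMD_t pmd iM)].
suff -> : star_Max star = star_Max (@t_op R) by [].
rewrite /star_Max; apply/seteqP; split=> M [pM hM]; split; rewrite ?pE // -?pE //.
  by move=> N; rewrite -pE; apply: hM.
by move=> N; rewrite pE; apply: hM.
Qed.

(** If [x J] lies in [J], then [x] multiplies [J (R : J)] into [R], hence also its closure, which is
    [R]. *)
Lemma PstarMD_integrally_closed : PstarMD star -> integrally_closed R.
Proof.
move=> pmd x /fg_of_integral[J fJ xJ]; have iJ := fg_ideal fJ.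
have J1 : star (ideal_mul J (colon OK J)) 1 by rewrite pmd.
rewrite -[x]mulr1 -(star_ring star_op); apply: star_mulr J1 => //.
  by apply: ideal_mul_ideal => //; apply: colon_ideal.
rewrite star_ring //; apply: (@ideal_mul_min _ J _ [set y | OK (x * y)]).
  split; rewrite /= ?mulr0; first exact: sub0.
    by move=> a b; rewrite mulrDr; apply: subD.
  by move=> r a; rewrite mulrCA; apply: subM.
by move=> a b Ja Jb /=; rewrite mulrA mulrC; apply/Jb/xJ.
Qed.

End StarMultiplication.

(** * Localizations of a P*MD and Clifford regularity *)

Section PstarMDLocalization.
Variables (R : idomainType) (star : operation R).
Hypotheses (star_op : is_star_operation star) (star_ft : finite_type star).
Hypothesis pmd : PstarMD star.
Local Notation K := {fraction R}.
Local Notation OK := (@ringR R).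
Implicit Types (I J L M N Q : set K) (x y z c : K) (r s d e : R).

Hint Resolve ideal_sub ringR_submodule ringR1 ringR_tofrac : core.
Hint Resolve ideal_ringR fg_ideal submodule_mul tilde_submodule loc_submodule : core.

(** If all products [x y] were in [M], so would be [I (R : I)]. The [x] obtained generates [I_M],
    since [z = x (y z) / (x y)]. *)
Lemma PstarMD_unit I M : is_fg_ideal I -> star_Max star M ->
  exists x y, [/\ I x, colon OK I y & ~ M (x * y)].
Proof.
move=> fI MM; apply: contrapT => h; apply: (PstarMD_notin_Max star_op pmd fI MM).
apply: ideal_mul_min; first exact: Max_sub MM.
by move=> x y Ix Iy; apply: contrapT => Mxy; apply: h; exists x, y.
Qed.

(** Invert the ideal generated by [1] and [x]: some [y] has [y] and [y x] in [R], not both in [M].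
    Their quotient is [x] or its inverse. *)
Lemma loc_valuation M x : star_Max star M ->
  loc M OK x \/ x != 0 /\ loc M OK x^-1.
Proof.
move=> MM; have sM := Max_sub MM.
pose g (b : bool) : K := if b then 1 else x.
have fI : is_fg_ideal (Rspan g) by apply: (@Rspan_fg _ _ g true); rewrite oner_eq0.
have [_ [y [[a ->] yI]]] := PstarMD_unit fI MM.
have Ry : OK y by rewrite -[y]mulr1; apply/yI/(Rspan_mem g true).
have Rxy : OK (y * x) by apply/yI/(Rspan_mem g false).
have [My|nMy] := pselect (M y); last first.
  by left; case: Ry nMy Rxy => s _ <- Ms Rsx; exists s.
have [Mxy|nMxy] := pselect (M (y * x)).
  case; rewrite big_bool /= mulrDl mulr1; apply: subD => //; first exact: subM.
  by rewrite -mulrA [x * y]mulrC; apply: subM.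
move=> _; right.
have x0 : x != 0 by apply/eqP => x0; apply: nMxy; rewrite x0 mulr0; apply: sub0.
split=> //; case: Rxy nMxy => t _ et Mt; exists t; first by rewrite et.
by rewrite et mulfK.
Qed.

Lemma loc_div_cases M I x y : star_Max star M -> is_submodule I ->
  y != 0 -> I x -> loc M OK (x / y) \/ loc M I y.
Proof.
move=> MM sI y0 Ix; have [h|[xy0 h]] := loc_valuation (x / y) MM; first by left.
have x0 : x != 0 by apply: contra_neq xy0 => ->; rewrite mul0r.
right; have -> : y = (x / y)^-1 * x by rewrite invf_div divfK.
exact: (loc_mul star_op star_ft MM sI h (loc_sub MM Ix)).
Qed.

(* For [z] in [I], either [I^2] is contained in [z I], and
   [z = z z z^-1], or [a b / z] is not in [I_M] for some [a], [b] in [I], and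
   then [z / (a b)] maps [I] into [R_M]. *)
Lemma loc_clifford M I z : star_Max star M -> is_submodule I -> I z -> z != 0 ->
  exists a b c, [/\ I a, I b, z = a * b * c &
    forall u v, I u -> I v -> loc M I (c * u * v)].
Proof.
move=> MM sI Iz z0.
have [h|] := pselect (forall a b, I a -> I b -> loc M I (a * b / z)).
  exists z, z, z^-1; split=> //; first by rewrite mulfK.
  by move=> u v Iu Iv; rewrite -mulrA mulrC; apply: h.
move=> /existsNP[a /existsNP[b /not_implyP[Ia /not_implyP[Ib nab]]]].
have ab0 : a * b != 0.
  apply/eqP => ab0; apply: nab; rewrite ab0 mul0r.
  exact: (sub0 (loc_submodule star_op star_ft MM sI)).
exists a, b, (z / (a * b)); split=> //; first by rewrite mulrC divfK.
move=> u v Iu Iv; apply: (loc_mul star_op star_ft MM sI); last exact: (loc_sub MM).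
have y0 : a * b / z != 0 by rewrite mulf_neq0 ?invr_eq0.
have [|//] := loc_div_cases MM sI y0 Iu.
by rewrite invf_div mulrC.
Qed.

(* If [I_M] is contained in [I_N], take [s = 1]. Otherwise some [y] in [I_M]
   divides every element of [I] in the valuation ring [R_N], and a multiple of
   [y] prime to [M] lies in [I]. *)
Lemma loc_clifford_move M N I c : star_Max star M -> star_Max star N ->
  is_submodule I -> (forall u v, I u -> I v -> loc M I (c * u * v)) ->
  exists s, ~ M s%:F /\ forall u v, I u -> I v -> loc N I (s%:F * c * u * v).
Proof.
move=> MM MN sI cI.
have [h|] := pselect (loc M I `<=` loc N I).
  exists 1; rewrite tofrac1; split; first exact: Max1 MM.
  by move=> u v Iu Iv; rewrite mul1r; apply/h/cI.
move=> /existsNP[y /not_implyP[[s Ms Isy] nIy]].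
have y0 : y != 0.
  apply/eqP => y0; apply: nIy; rewrite y0.
  exact: (sub0 (loc_submodule star_op star_ft MN sI)).
have divy u : I u -> loc N OK (u / y).
  by move=> Iu; case: (loc_div_cases MN sI y0 Iu).
have [t Mt It] := cI _ _ Isy Isy.
exists (t * s * s * s); split.
  by do 3![apply: (Max_primeR star_op star_ft MM) => //].
move=> u v Iu Iv.
have -> : (t * s * s * s)%:F * c * u * v =
  u / y * (v / y) * (t%:F * (c * (s%:F * y) * (s%:F * y)) / y) * (s%:F * y).
  transitivity ((t * s * s * s)%:F * c * u * v * (y / y) * (y / y) * (y / y)).
    by rewrite divff // !mulr1.
  by rewrite !tofracM; ring.
have sO x z := @loc_mul _ _ star_op star_ft N MN OK x z (ringR_submodule R).
apply: (loc_mul star_op star_ft MN sI); last exact: (loc_sub MN).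
by apply: (sO); [apply: (sO); exact: divy|exact: divy].
Qed.

(** At a *-maximal ideal [N] missing [e] this puts [c I^2] into [I_N]; by finite character only
    finitely many others remain. *)
Lemma loc_clifford_generic I c : is_ideal I -> exists2 e, e != 0 &
  forall u v, I u -> I v -> I (e%:F * (c * u * v)).
Proof.
move=> [sI [x Ix x0] [d d0 Id]].
have [p [q [q0 ex]]] := fraction_numden x.
have [n [m [m0 ec]]] := fraction_numden c.
have ep : p%:F = q%:F * x by rewrite ex mulrC divfK // tofrac_eq0.
have en : n%:F = m%:F * c by rewrite ec mulrC divfK // tofrac_eq0.
(* [m] clears [c], each [d] clears one factor from [I], and [p = q x] brings the result back into
   [I]. *)
exists (m * d * d * p).
  rewrite !mulf_neq0 //.
  by apply: contra_neq x0; rewrite ex => ->; rewrite tofrac0 mul0r.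
move=> u v /Id Ru /Id Rv; rewrite !tofracM ep.
have -> : m%:F * d%:F * d%:F * (q%:F * x) * (c * u * v) =
  (n * q)%:F * ((d%:F * u) * ((d%:F * v) * x)) by rewrite tofracM en; ring.
by apply: subM => //; apply: subMR => //; apply: subMR.
Qed.

Lemma tilde_ideal I : is_ideal I -> is_ideal (tilde star I).
Proof.
move=> [sI [x Ix x0] [d d0 Id]]; split; first by auto.
  by exists x => //; apply: tilde_sub.
exists d => // y /(tildeP star_op star_ft _ sI) ty.
apply: (ringR_of_loc star_op star_ft) => M MM; have [s Ms Isy] := ty _ MM.
by exists s => //; rewrite mulrCA; apply: Id.
Qed.

Lemma PstarMD_clifford : star_finite_character star -> clifford_regular (tilde star).
Proof.
move=> fc I iI; have sI := ideal_sub iI.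
have iII : is_ideal (ideal_mul I I) by apply: ideal_mul_ideal.
have sIIJ J : is_submodule (ideal_mul (ideal_mul I I) J) by do 2!apply: submodule_mul.
(* The colon is taken into [tilde star I] because membership there is tested at each *-maximal ideal
   separately. *)
pose J := colon (tilde star I) (ideal_mul I I); exists J.
  by apply: colon_ideal => //; apply: tilde_ideal.
apply/seteqP; split=> x /(tildeP star_op star_ft) xI; last first.
  apply/(tildeP star_op star_ft _ sI) => M MM; have [s Ms IIJx] := xI (sIIJ J) _ MM.
  apply: (loc_div star_op star_ft MM Ms).
  apply: (tilde_loc star_op star_ft sI MM); move: IIJx; apply: ideal_mul_min.
    exact: tilde_submodule.
  by move=> y c IIy Jc; rewrite mulrC; apply: Jc.
apply/(tildeP star_op star_ft _ (sIIJ J)) => M MM; have [s Ms] := xI sI _ MM.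
move=> Isx; apply: (loc_div star_op star_ft MM Ms).
move: (s%:F * x) Isx => z Iz {x xI s Ms}.
have [->|z0] := eqVneq z 0.
  exact: (sub0 (loc_submodule star_op star_ft MM (sIIJ J))).
have [a [b [c [Ia Ib ez cI]]]] := loc_clifford MM sI Iz z0.
have [e e0 eI] := loc_clifford_generic c iI.
(* [f N] lies outside the fixed [M] and [f N c I^2] lies in [I_N]; the value is [1] where [N] is not
   *-maximal. *)
have /choice[f fP] : forall N, exists s, ~ M s%:F /\ (star_Max star N ->
    forall u v, I u -> I v -> loc N I (s%:F * c * u * v)).
  move=> N; have [MN|nMN] := pselect (star_Max star N).
    by have [s [Ms sN]] := loc_clifford_move MM MN sI cI; exists s.
  by exists 1; split=> //; rewrite tofrac1; apply: Max1 MM.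
have /finite_seqP[F eF] := fc e e0.
(* The product is finite by finite character. It will follow that [s c] lies in [J], and
   [s z = a b (s c)]. *)
pose s := \prod_(N <- F) f N.
have Ms : ~ M s%:F by apply: (Max_prod star_op star_ft MM) => N _; case: (fP N).
exists s => //; rewrite ez mulrCA; apply: ideal_mulI; first exact: ideal_mulI.
move=> p; apply: (@ideal_mul_min _ I I [set p | tilde star I (s%:F * c * p)]).
  have sT := tilde_submodule star_op star_ft sI.
  split; rewrite /= ?mulr0; first exact: (sub0 sT).
    by move=> y y' ? ?; rewrite mulrDr; apply: (subD sT).
  by move=> r y ?; rewrite mulrCA; apply: (subM _ sT).
move=> u v Iu Iv /=; apply/(tildeP star_op star_ft _ sI) => N MN.
(* Where [N] misses [e], the denominator [e] suffices; otherwise [f N] is one of the factors of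
   [s]. *)
have [Ne|nNe] := pselect (N e%:F); last first.
  apply: (loc_div star_op star_ft MN nNe); apply: (loc_sub MN).
  have -> : e%:F * (s%:F * c * (u * v)) = s%:F * (e%:F * (c * u * v)) by ring.
  by apply: subM => //; apply: eI.
have NF : N \in F by have : [set` F] N by rewrite -eF.
have -> : s%:F * c * (u * v) =
    (\prod_(L <- rem N F) f L)%:F * ((f N)%:F * c * u * v).
  by rewrite /s (perm_big _ (perm_to_rem NF)) big_cons tofracM; ring.
by apply: subM; [exact: (loc_submodule star_op star_ft MN)|case: (fP N) => _; apply].
Qed.

End PstarMDLocalization.

(** * Finite character *)

Section FiniteCharacter.
Variables (R : idomainType) (star : operation R).
Hypotheses (star_op : is_star_operation star) (star_ft : finite_type star).
Hypothesis pmd : PstarMD star.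
Local Notation K := {fraction R}.
Local Notation OK := (@ringR R).
Implicit Types (I J L M N Q U V W : set K) (x y z b : K) (r s a : R).

Hint Resolve ideal_sub ringR_submodule ringR1 ringR_tofrac : core.
Hint Resolve ideal_ringR fg_ideal submodule_mul tilde_submodule loc_submodule : core.

(** * Sequences of ideals no two of which share a *-maximal ideal *)

Section ComaximalSequence.
Variables (a : R) (A : nat -> set K).
Hypotheses (a0 : a != 0) (A_fg : forall n, is_fg_ideal (A n)).
Hypotheses (Aa : forall n, A n a%:F).
Hypothesis A_proper : forall n, exists2 M, star_Max star M & A n `<=` M.
Hypothesis A_comax : forall m n M, (m < n)%N -> star_Max star M ->
  A m `<=` M -> A n `<=` M -> False.

(** Only the inverses of [A k] with [k < n] occur in [B n]; that of [A n] enters at stage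
    [n + 1]. *)
Fixpoint partial_sum n : set K :=
  if n is m.+1 then addI (partial_sum m) (colon OK (A m)) else OK.
Local Notation B := partial_sum.
Local Notation BB := (\bigcup_(n in [set: nat]) B n).

Lemma A_colon_ideal n : is_ideal (colon OK (A n)).
Proof. by apply: colon_ideal; auto. Qed.

Lemma partial_sum_ideal n : is_ideal (B n).
Proof. by elim: n => //= n IH; apply: addI_ideal => //; apply: A_colon_ideal. Qed.
Hint Resolve partial_sum_ideal A_colon_ideal : core.

Lemma partial_sumS m n : (m <= n)%N -> B m `<=` B n.
Proof.
elim: n => [|n IH]; first by rewrite leqn0 => /eqP ->.
rewrite leq_eqVlt => /predU1P[-> //|/IH h]; apply: subset_trans h _ => /=.
by apply: addI_l; auto.
Qed.

Lemma colon_partial_sum n : colon OK (A n) `<=` B n.+1.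
Proof. by apply: addI_r; auto. Qed.

(** As [a] lies in every [A k], it is a common denominator of all their inverses; this makes the
    infinite sum a fractional ideal. *)
Lemma partial_sum_denom n x : B n x -> OK (a%:F * x).
Proof.
pose D := [set x | OK (a%:F * x)].
have sD : is_submodule D.
  split; rewrite /D /= ?mulr0; first exact: sub0.
    by move=> y z ? ?; rewrite mulrDr; apply: subD.
  by move=> r y ?; rewrite mulrCA; apply: subM.
suff : B n `<=` D by apply.
elim: n => [|n IH] /=; first by move=> y Ry; rewrite /D /=; apply: ringRM.
apply: addI_min => // y yA; rewrite /D /= mulrC; exact: yA.
Qed.

Lemma sum_ideal : is_ideal BB.
Proof.
split.
- split; first by exists 0%N => //; apply: sub0.
    move=> x y [m _ Bx] [n _ By]; exists (maxn m n) => //.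
    by apply: subD; [auto|move: Bx|move: By]; apply: partial_sumS;
       rewrite ?leq_maxl ?leq_maxr.
  by move=> r x [n _ Bx]; exists n => //; apply: subM; auto.
- by exists 1; [exists 0%N => //; exact: ringR1|rewrite oner_eq0].
- by exists a => // x [n _]; apply: partial_sum_denom.
Qed.

Lemma sum1 : BB 1. Proof. by exists 0%N => //; exact: ringR1. Qed.

Lemma A_integral n : A n `<=` OK.
Proof.
by have [M MM AM] := A_proper n; apply: subset_trans AM (Max_integral MM).
Qed.

Lemma colon_A_loc M n : star_Max star M -> ~ A n `<=` M ->
  colon OK (A n) `<=` loc M OK.
Proof.
move=> MM /existsNP[t /not_implyP[At nMt]] y yA.
have [s _ es] := A_integral At; exists s; first by rewrite es.
by rewrite es mulrC; apply: yA.
Qed.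

Lemma partial_sum_loc M n : star_Max star M ->
  (forall k, (k < n)%N -> ~ A k `<=` M) -> B n `<=` loc M OK.
Proof.
move=> MM; elim: n => [|n IH] nA /=; first exact: loc_sub MM _.
apply: addI_min; first exact: loc_submodule star_op star_ft _ MM _ _.
  by apply: IH => k kn; apply: nA; apply: ltnW.
by apply: colon_A_loc => //; apply: nA.
Qed.

(** At most one [A k] lies in [M], and all other inverses localize into [R_M]. So [BB_M] is [R_M] or
    the localized inverse of [A k], which is principal. *)
Lemma sum_loc_principal M : star_Max star M -> exists b,
  [/\ BB b, b != 0 & forall y, BB y -> loc M OK (y / b)].
Proof.
move=> MM; have [[k AkM]|nA] := pselect (exists k, A k `<=` M); last first.
  exists 1; split; [exact: sum1|exact: oner_neq0|move=> y [n _ By]].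
  rewrite divr1; apply: (partial_sum_loc MM) By => k _ AkM.
  by apply: nA; exists k.
have [x [b [Ax bA nMxb]]] := PstarMD_unit star_op pmd (A_fg k) MM.
have sM := Max_sub MM.
have b0 : b != 0 by apply/eqP => b0; apply: nMxb; rewrite b0 mulr0; apply: sub0.
(* [y / b = (y x) / (x b)], with denominator [x b] outside [M]. *)
have divb y : OK (y * x) -> loc M OK (y / b).
  move=> Ry; have [s _ es] : OK (x * b) by rewrite mulrC; apply: bA.
  exists s; first by rewrite es.
  by rewrite es mulrACA mulrCA mulrA mulrAC divff // mul1r mulrC.
have sL := loc_submodule star_op star_ft MM (ringR_submodule R).
pose D := [set y | loc M OK (y / b)].
have sD : is_submodule D.
  split; rewrite /D /= ?mul0r; first exact: (sub0 sL).
    by move=> y z ? ?; rewrite mulrDl; apply: (subD sL).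
  by move=> r y ?; rewrite -mulrA; apply: (subM _ sL).
have DR : OK `<=` D.
  by move=> y Ry; apply: divb; apply: ringRM => //; apply: A_integral Ax.
exists b; split=> //; first by exists k.+1 => //; apply: colon_partial_sum.
move=> y [n _]; suff : B n `<=` D by apply.
elim: n => [|n IH] //=; apply: addI_min => // z zA.
have [nk|nk] := eqVneq n k; first by apply: divb; apply: zA; rewrite nk.
have nAM : ~ A n `<=` M.
  by move=> AnM; case: (ltngtP n k) nk => // ltnk _; apply: (A_comax ltnk MM).
have zL := colon_A_loc MM nAM zA.
rewrite /D /= -[z]mulr1 -mulrA.
by apply: (loc_mul star_op star_ft MM (ringR_submodule R) zL); apply: DR.
Qed.

Lemma comaximal_sequence_finite : clifford_regular (tilde star) -> False.
Proof.
move=> cr; have iB := sum_ideal; have sB := ideal_sub iB.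
have [J iJ eBJ] := cr _ iB; rewrite ideal_mulA // in eBJ.
set Q := ideal_mul BB J in eBJ; have iQ : is_ideal Q by exact: ideal_mul_ideal.
have sBQ : is_submodule (ideal_mul BB Q) by exact: submodule_mul.
(* At [M], with [b] generating [BB_M], the product [x b] lies in [BB_M = b R_M], so [x] is in
   [R_M]. *)
have QR : Q `<=` OK.
  move=> x Qx; apply: (ringR_of_loc star_op star_ft) => M MM.
  have [b [Bb b0 Bdiv]] := sum_loc_principal MM.
  have [s Ms Bs] : loc M BB (x * b).
    apply: (tilde_loc star_op star_ft sB MM); rewrite eBJ.
    by apply: (tilde_sub star_op star_ft sBQ); rewrite mulrC; apply: ideal_mulI.
  apply: (loc_div star_op star_ft MM Ms).
  by have := Bdiv _ Bs; rewrite mulrA mulfK.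
(* If [Q] were inside [M], then [BB Q] would lie in [b M R_M]; but [b] is in its localization, which
   would put [1] in [M R_M]. *)
have QM M : star_Max star M -> ~ Q `<=` M.
  move=> MM QM; have [b [Bb b0 Bdiv]] := sum_loc_principal MM.
  have sML := loc_submodule star_op star_ft MM (Max_sub MM).
  have BQ y : ideal_mul BB Q y -> loc M M (y / b).
    apply: (@ideal_mul_min _ BB Q [set y | loc M M (y / b)]).
      split; rewrite /= ?mul0r; first exact: (sub0 sML).
        by move=> u v ? ?; rewrite mulrDl; apply: (subD sML).
      by move=> r u ?; rewrite -mulrA; apply: (subM _ sML).
    move=> u v Bu Qv /=; rewrite mulrAC mulrC.
    by apply: (loc_max MM); [exact: QM|exact: Bdiv].
  have [s Ms BQs] : loc M (ideal_mul BB Q) b.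
    apply: (tilde_loc star_op star_ft sBQ MM); rewrite -eBJ.
    exact: (tilde_sub star_op star_ft sB).
  have [t Mt] := BQ _ BQs; rewrite mulfK // -tofracM.
  exact: (Max_primeR star_op star_ft MM).
have Q1 : star Q 1 by apply: (star1_of_Max star_op star_ft).
pose F := range (fun n => ideal_mul (B n) J).
have iF X : F X -> is_ideal X by move=> [n _ <-]; apply: ideal_mul_ideal.
have tF X Y : F X -> F Y -> X `<=` Y \/ Y `<=` X.
  move=> [m _ <-] [n _ <-]; case: (leqP m n) => mn; [left|right];
    by apply: ideal_mulSS => //; apply: partial_sumS => //; apply: ltnW.
have nF : exists X, F X by exists (ideal_mul (B 0%N) J); exists 0%N.
have eQ : Q = \bigcup_(X in F) X.
  apply/seteqP; split; last first.
    by move=> x [_ [n _ <-]]; apply: ideal_mulSS => // y By; exists n.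
  have inF n x : ideal_mul (B n) J x -> (\bigcup_(X in F) X) x.
    by move=> h; exists (ideal_mul (B n) J) => //; exists n.
  apply: ideal_mul_min; last by move=> x y [n _ Bx] Jy; apply: (inF n); apply: ideal_mulI.
  split; first by apply: (inF 0%N); apply: sub0; apply: submodule_mul.
    move=> x y [X FX Xx] [Y FY Yy]; have [XY|YX] := tF _ _ FX FY.
      by exists Y => //; apply: subD; auto.
    by exists X => //; apply: subD; auto.
  by move=> r x [X FX Xx]; exists X => //; apply: subM; auto.
rewrite eQ in iQ Q1; have [_ [n _ <-] BJ1] := star_chain star_op star_ft nF iF tF iQ Q1.
rewrite -eQ in iQ.
(* No [A k] with [k < n] lies in this [M], so [B n] lies in [R_M]. The aim is that [B n J] lies in
   [M], against [1] being in its closure. *)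
have [M MM AM] := A_proper n; have sM := Max_sub MM.
have := Max_star1 star_op MM (ideal_mul_ideal (partial_sum_ideal n) iJ) BJ1; apply.
have nA k : (k < n)%N -> ~ A k `<=` M by move=> kn AkM; apply: (A_comax kn MM).
apply: ideal_mul_min => // b j Bb Jj; apply: contrapT => nMbj.
have BBb : BB b by exists n.
have RJ x : BB x -> OK (x * j) by move=> Bx; apply/QR/ideal_mulI.
have Rj : OK j by rewrite -[j]mul1r; apply/RJ/sum1.
have [s Ms Rsb] := partial_sum_loc MM nA Bb.
have nMj : ~ M j.
  move=> Mj; have : M (s%:F * (b * j)) by rewrite mulrA; apply: subMR.
  by case/(Max_prime star_op star_ft MM) => //; apply: RJ.
(* [x y] is outside [M], but [x y j] is in [M] because [y j] is in [R] and [x] in [A n]; so [j]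
   would be in [M]. *)
have [x [y [Ax yA]]] := PstarMD_unit star_op pmd (A_fg n) MM; apply.
have Ry : OK (y * j) by apply: RJ; exists n.+1 => //; apply: colon_partial_sum.
have : M (x * y * j) by rewrite -mulrA mulrC; apply: subMR => //; apply: AM.
by case/(Max_prime star_op star_ft MM) => //; rewrite mulrC; apply: yA.
Qed.

End ComaximalSequence.
(** For [x] in [M] but not in [N], finite type gives a finitely generated [F] inside [N + x R] with
    [1] in [F^*]. [U] collects the parts of its generators in [N] and [V] contains [x], so an ideal
    above both contains [F]. *)
Lemma Max_separation W M N : is_fg_ideal W -> W `<=` M -> W `<=` N ->
  star_Max star M -> star_Max star N -> N <> M ->
  exists U V, [/\ is_fg_ideal U, W `<=` U & U `<=` N] /\
    [/\ is_fg_ideal V, W `<=` V, V `<=` M &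
      forall L, star_Max star L -> U `<=` L -> V `<=` L -> False].
Proof.
move=> fW WM WN MM MN neNM; have iW := fg_ideal fW.
have sM := Max_sub MM; have sN := Max_sub MN.
have [x [Mx nNx]] : exists x, M x /\ ~ N x.
  apply: contrapT => h; apply: neNM; have [_ maxM] := MM; apply: maxM; first by case: MN.
  by move=> x Mx; apply: contrapT => nNx; apply: h; exists x.
have x0 : x != 0 by apply/eqP => x0; apply: nNx; rewrite x0; apply: sub0.
pose X := [set r%:F * x | r in [set: R]].
have fX : is_fg_ideal X := principal_fg x0.
have := Max_adjoin star_op star_ft MN (Max_integral MM Mx) nNx.
move/(star_fgP star_ft (addI_ideal (Max_ideal MN) (fg_ideal fX))) => [F [fF FNX F1]].
have [n [g eF]] := fg_span fF.
have /choice[h hP] : forall i, exists y, N y /\ exists2 z, X z & g i = y + z.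
  move=> i; have [y [z [Ny Xz e]]] : addI N X (g i).
    by apply: FNX; rewrite eF; apply: Rspan_mem.
  by exists y; split=> //; exists z.
have [|U0 [fU0 U0N hU0]] := @fg_cover _ _ h N (Max_ideal MN).
  by move=> i; case: (hP i).
have iU0 := fg_ideal fU0; have iX := fg_ideal fX.
exists (addI U0 W), (addI X W); split; split.
- exact: addI_fg.
- by apply: addI_r; auto.
- exact: addI_min.
- exact: addI_fg.
- by apply: addI_r; auto.
- by apply: addI_min => // _ [r _ <-]; apply: subM.
move=> L ML U0L XL; have sL := Max_sub ML.
apply: (Max_star1 star_op ML (fg_ideal fF) F1); rewrite eF.
apply: Rspan_min => // i; have [_ [z Xz ->]] := hP i; apply: subD => //.
  by apply: U0L; apply: addI_l => //; auto.
by apply: XL; apply: addI_l => //; auto.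
Qed.

(* The sets of *-maximal ideals containing a given finitely generated ideal are
   a basis of a Hausdorff topology, and an infinite Hausdorff space has
   infinitely many disjoint nonempty open sets: either some point is not
   isolated, and one separates it from ever closer points, or all points are
   isolated. *)
Lemma clifford_finite_character :
  clifford_regular (tilde star) -> star_finite_character star.
Proof.
move=> cr a a0; apply: contrapT => infV.
have aK0 : a%:F != 0 :> K by rewrite tofrac_eq0.
have [[M [[MM Ma] accM]]|isolated] :=
  pselect (exists M, (star_Max star M /\ M a%:F) /\
    forall W, is_fg_ideal W -> W a%:F -> W `<=` M ->
      exists N, [/\ star_Max star N, W `<=` N & N <> M]).
  have /choice[f fP] : forall W, exists p : set K * set K,
      is_fg_ideal W /\ W a%:F /\ W `<=` M ->
      [/\ is_fg_ideal p.1, W `<=` p.1 & exists2 N, star_Max star N & p.1 `<=` N] /\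
      [/\ is_fg_ideal p.2, W `<=` p.2, p.2 `<=` M &
        forall L, star_Max star L -> p.1 `<=` L -> p.2 `<=` L -> False].
    move=> W; have [[fW [Wa WM]]|nW] :=
      pselect (is_fg_ideal W /\ W a%:F /\ W `<=` M); last first.
      by exists (W, W).
    have [N [MN WN neNM]] := accM W fW Wa WM.
    have [U [V [[fU WU UN] HV]]] := Max_separation fW WM WN MM MN neNM.
    by exists (U, V) => _; split=> //; split=> //; exists N.
  (* [W 0 = a R]. Of the two ideals separated at stage [n], the first serves as [A n] and the
     second, still inside [M], is [W (n + 1)]. *)
  pose W n := iter n (fun W => (f W).2) [set r%:F * a%:F | r in [set: R]].
  have WP n : is_fg_ideal (W n) /\ W n a%:F /\ W n `<=` M.
    elim: n => [|n IH].
      split; first exact: principal_fg.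
      split; first by exists 1; rewrite ?tofrac1 ?mul1r.
      by move=> _ [r _ <-]; apply: subM => //; apply: Max_sub MM.
    have [_ [fV WV VM _]] := fP _ IH; rewrite /W iterS -/(W n); split=> //.
    by split=> //; apply: WV; have [_ []] := IH.
  have Wle m n : (m <= n)%N -> W m `<=` W n.
    elim: n => [|n IH]; first by rewrite leqn0 => /eqP ->.
    rewrite leq_eqVlt => /predU1P[-> //|/IH h]; apply: (subset_trans h).
    by have [_ []] := fP _ (WP n).
  apply: (@comaximal_sequence_finite a (fun n => (f (W n)).1)) => // n.
  - by have [[]] := fP _ (WP n).
  - by have [[_ Wf _] _] := fP _ (WP n); apply: Wf; have [_ []] := WP n.
  - by have [[_ _ []]] := fP _ (WP n) => N; exists N.
  (* For [n < p], [A p] contains [W p] and so [W (n + 1)], which shares no *-maximal ideal with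
     [A n]. *)
  - move=> p N np MN AnN ApN; have [_ [_ _ _ sep]] := fP _ (WP n).
    apply: (sep N MN AnN); apply: subset_trans ApN; apply: (subset_trans (Wle n.+1 p np)).
    by have [[_ + _] _] := fP _ (WP p).
have /choice[W WP] : forall M, exists W, star_Max star M /\ M a%:F ->
    [/\ is_fg_ideal W, W a%:F, W `<=` M &
      forall N, star_Max star N -> W `<=` N -> N = M].
  move=> M; have [MMa|nMa] := pselect (star_Max star M /\ M a%:F); last by exists M.
  apply: contrapT => h; apply: isolated; exists M; split=> // W fW Wa WM.
  apply: contrapT => nN; apply: h; exists W => _; split=> // N MN WN.
  by apply: contrapT => neNM; apply: nN; exists N.
(* [phi] injects the natural numbers into the *-maximal ideals containing [a]; the ideals isolating
   its values form the sequence. *)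
move: infV => /infiniteP/pcard_leP/unsquash phi.
have VP n : star_Max star (phi n) /\ phi n a%:F by exact: (@funS _ _ _ _ phi n I).
apply: (@comaximal_sequence_finite a (fun n => W (phi n))) => // n.
- by case: (WP _ (VP n)).
- by case: (WP _ (VP n)).
- by exists (phi n); [case: (VP n)|case: (WP _ (VP n))].
- move=> p N np MN WnN WpN.
  have [_ _ _ /(_ N MN WnN) en] := WP _ (VP n).
  have [_ _ _ /(_ N MN WpN) ep] := WP _ (VP p).
  suff e : n = p by rewrite e ltnn in np.
  exact: (@injT _ _ phi n p (etrans (esym en) ep)).
Qed.

End FiniteCharacter.

Theorem theorem4p4 (R : idomainType) (star : operation R)
    (star_op : is_star_operation star) (star_ft : finite_type star) :
  (star_integrally_closed star -> clifford_regular star -> PvMD R) /\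
  ((star_integrally_closed (tilde star) /\ clifford_regular (tilde star) <->
    integrally_closed R /\ clifford_regular (tilde star)) /\
   (integrally_closed R /\ clifford_regular (tilde star) <->
    PstarMD star /\ star_finite_character star) /\
   ((star_integrally_closed (tilde star) /\ clifford_regular (tilde star)) \/
    (integrally_closed R /\ clifford_regular (tilde star)) \/
    (PstarMD star /\ star_finite_character star) ->
    forall I : set {fraction R}, is_ideal I -> tilde star I = w_op I)).
Proof.
have tic := tilde_integrally_closed star_op star_ft.
have pmd : integrally_closed R /\ clifford_regular (tilde star) -> PstarMD star.
  by case; apply: clifford_PstarMD.
split; first exact: clifford_PvMD.
split; first by rewrite tic.
split.
  split=> [ic|[pm fc]].
    by split; [exact: pmd|apply: clifford_finite_character => //; [exact: pmd|case: ic]].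
  by split; [exact: PstarMD_integrally_closed pm|exact: PstarMD_clifford].
move=> h I _; apply: PstarMD_w => //.
by case: h => [[/tic ic cr]|[|[]//]]; exact: pmd.
Qed.
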